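(* Let $R$ be a left coherent ring, $G$ a finite group acting on $R$, and $H$ a subgroup of $G$. If the skew group ring $RG$ is a right IF-ring, then $RH$ is a right IF-ring. Moreover, if $RG$ is a separable extension over $RH$, then $RG$ is a right IF-ring if and only if $RH$ is a right IF-ring.
   Context: Rings are associative with identity; modules are unitary. $G$ acts on $R$ by ring automorphisms: $r\mapsto g(r)$ is a ring automorphism for each $g\in G$, $(g_1g_2)(r)=g_1(g_2(r))$ and $1(r)=r$. The skew group ring $RG$ is the free left $R$-module with basis $G$ and multiplication $(ag)(bh)=a\,g(b)\,gh$ for $a,b\in R$, $g,h\in G$. For a subgroup $H\le G$ (with the restricted action), $RH$ is a subring of $RG$. A ring $A$ is a separable extension over a subring $S$ if the multiplication map $A\otimes_S A\to A$, $a\otimes b\mapsto ab$, splits as a map of $A$-$A$-bimodules; i.e. there is $\sum_i a_i\otimes b_i\in A\otimes_S A$ with $\sum_i a_i\otimes b_i a=\sum_i a a_i\otimes b_i$ for all $a\in A$ and $\sum_i a_ib_i=1$. A ring $A$ is a right IF-ring if every injective right $A$-module is flat. *)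

(* Defs.v *)
From HB Require Import structures.
From mathcomp Require Import all_fingroup all_boot all_order all_algebra.
From mathcomp Require Import boolp freeg.

Set Implicit Arguments.
Unset Strict Implicit.
Unset Printing Implicit Defensive.

Import GRing.Theory.

Local Open Scope ring_scope.
Local Open Scope quotient_scope.

(* Rings are [pzRingType] (associative, with identity, possibly zero).
   Left A-modules are [lmodType A]; right A-modules are [lmodType A^c], where
   A^c is the converse ring, so m a is written [a *: m] with a : A^c. *)

Section Tensor.
Variables (A : pzRingType) (M : lmodType A^c) (N : lmodType A).

Local Notation free := {freeg (M * N)%type / int}.

(* The subgroup of the free abelian group on M x N generated by the relations
   of additivity in each variable and of A-balancedness. *)
Inductive tensor_rel : free -> Prop :=
| tensor_rel0 : tensor_rel 0
| tensor_relB x y : tensor_rel x -> tensor_rel y -> tensor_rel (x - y)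
| tensor_relDl m m' n :
    tensor_rel (<< (m + m', n) >> - << (m, n) >> - << (m', n) >>)
| tensor_relDr m n n' :
    tensor_rel (<< (m, n + n') >> - << (m, n) >> - << (m, n') >>)
| tensor_relZ m (a : A) n :
    tensor_rel (<< ((a : A^c) *: m, n) >> - << (m, a *: n) >>).

Definition tensor_relb (x : free) : bool := `[< tensor_rel x >].

Fact tensor_relb_zmod_closed : zmod_closed tensor_relb.
Proof.
split; first by apply/asboolP; exact: tensor_rel0.
by move=> x y /asboolP hx /asboolP hy; apply/asboolP; exact: tensor_relB.
Qed.

HB.instance Definition _ :=
  GRing.isZmodClosed.Build free tensor_relb tensor_relb_zmod_closed.

Definition tensor_relators : zmodClosed free :=
  GRing.ZmodClosed.clone _ tensor_relb _.

Definition tensor : Type := Quotient.quot tensor_relators.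
HB.instance Definition _ := GRing.Zmodule.on tensor.

Definition tens (m : M) (n : N) : tensor :=
  \pi_(Quotient.quot tensor_relators) << (m, n) >>.

Lemma tensor_pi0 (x : free) :
  tensor_rel x -> \pi_(Quotient.quot tensor_relators) x = 0.
Proof.
move=> hx; rewrite -(raddf0 (\pi_(Quotient.quot tensor_relators))).
by apply/eqP; rewrite -Quotient.idealrBE subr0; apply/asboolP.
Qed.

Lemma tensDl m m' n : tens (m + m') n = tens m n + tens m' n.
Proof.
have /tensor_pi0/eqP := tensor_relDl m m' n.
by rewrite !raddfB /= -addrA -opprD subr_eq0 => /eqP.
Qed.

Lemma tensDr m n n' : tens m (n + n') = tens m n + tens m n'.
Proof.
have /tensor_pi0/eqP := tensor_relDr m n n'.
by rewrite !raddfB /= -addrA -opprD subr_eq0 => /eqP.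
Qed.

Lemma tensZ m (a : A) n : tens ((a : A^c) *: m) n = tens m (a *: n).
Proof.
by have /tensor_pi0/eqP := tensor_relZ m a n; rewrite !raddfB /= subr_eq0 => /eqP.
Qed.

Definition balanced (T : zmodType) (b : M -> N -> T) : Prop :=
  [/\ forall m m' n, b (m + m') n = b m n + b m' n,
      forall m n n', b m (n + n') = b m n + b m n'
    & forall m (a : A) n, b ((a : A^c) *: m) n = b m (a *: n)].

Lemma tens_balanced : balanced tens.
Proof. by split; [exact: tensDl | exact: tensDr | exact: tensZ]. Qed.

(* The map induced by b on the tensor product; meaningful for balanced b only. *)
Definition tensor_lift (T : zmodType) (b : M -> N -> T) (x : tensor) : T :=
  fglift (fun p : M * N => (b p.1 p.2 : zmodule T)) (repr x).

Section Lift.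
Variables (T : zmodType) (b : M -> N -> T).
Hypothesis b_bal : balanced b.

Let F : free -> T := fglift (fun p : M * N => (b p.1 p.2 : zmodule T)).

Let FB x y : F (x - y) = F x - F y.
Proof. exact: (lift_is_additive (fun p : M * N => (b p.1 p.2 : zmodule T))). Qed.

Let FU m n : F << (m, n) >> = b m n.
Proof. by rewrite /F liftU /= scale1r. Qed.

Let F_rel x : tensor_rel x -> F x = 0.
Proof.
have [bDl bDr bZ] := b_bal.
elim=> [|{}x y _ Fx _ Fy|m m' n|m n n'|m a n].
- by rewrite -[0 in LHS](subrr (0 : free)) FB subrr.
- by rewrite FB Fx Fy subrr.
- by rewrite !FB !FU bDl addrAC addrK subrr.
- by rewrite !FB !FU bDr addrAC addrK subrr.
- by rewrite FB !FU bZ subrr.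
Qed.

Let liftE (x : free) :
  tensor_lift b (\pi_(Quotient.quot tensor_relators) x) = F x.
Proof.
apply/eqP; rewrite -subr_eq0 -FB; apply/eqP/F_rel/asboolP.
have: repr (\pi_(Quotient.quot tensor_relators) x) - x \in tensor_relb.
  by rewrite Quotient.idealrBE reprK.
by [].
Qed.

Lemma tensor_liftE m n : tensor_lift b (tens m n) = b m n.
Proof. by rewrite liftE FU. Qed.

Lemma tensor_lift_zmod_morphism : zmod_morphism (tensor_lift b).
Proof.
move=> x y; rewrite -[x]reprK -[y]reprK -raddfB !liftE; exact: FB.
Qed.

End Lift.

Lemma tensor_ind (P : tensor -> Prop) :
    P 0 -> (forall x y, P x -> P y -> P (x - y)) ->
    (forall m n, P (tens m n)) ->
  forall x, P x.
Proof.
move=> P0 PB Pt x; rewrite -[x]reprK -(freeg_sumE (repr x)).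
have PD y z : P y -> P z -> P (y + z).
  by move=> Py Pz; rewrite -[z]opprK -[- z]sub0r; apply/PB/PB.
have PM y (k : nat) : P y -> P (y *+ k).
  by move=> Py; elim: k => // k IH; rewrite mulrS; apply: PD.
rewrite raddf_sum; apply: (big_ind P) => // -[m n] _.
have -> : << coeff (m, n) (repr x) *g (m, n) >> =
    << (m, n) >> *~ coeff (m, n) (repr x) :> free.
  by rewrite freeg_mulz intz.
rewrite raddfMz; case: (coeff _ _) => k; first exact/PM/Pt.
by rewrite NegzE mulrNz -sub0r; apply/PB/PM/Pt.
Qed.

End Tensor.

Arguments tensor_lift {A M N T} b x.

(* id_M (x) f *)
Definition tensor_map (A : pzRingType) (M : lmodType A^c) (N N' : lmodType A)
    (f : N -> N') : tensor M N -> tensor M N' :=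
  tensor_lift (fun (m : M) n => tens m (f n)).

Arguments tensor_map {A} M {N N'} f x.

Section TensorMap.
Variables (A : pzRingType) (M : lmodType A^c) (N N' : lmodType A).
Variable f : {linear N -> N'}.

Fact tensor_map_balanced : balanced (fun (m : M) n => tens m (f n)).
Proof.
split=> [m m' n|m n n'|m a n]; first exact: tensDl.
  by rewrite linearD tensDr.
by rewrite linearZ tensZ.
Qed.

Lemma tensor_mapE m n : tensor_map M f (tens m n) = tens m (f n).
Proof. exact: (tensor_liftE tensor_map_balanced). Qed.

Lemma tensor_map_zmod_morphism : zmod_morphism (tensor_map M f).
Proof. exact: (tensor_lift_zmod_morphism tensor_map_balanced). Qed.

HB.instance Definition _ :=
  GRing.isZmodMorphism.Build (tensor M N) (tensor M N') (tensor_map M f)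
    tensor_map_zmod_morphism.

End TensorMap.

Definition flat_right_module (A : pzRingType) (M : lmodType A^c) : Prop :=
  forall (N N' : lmodType A) (f : {linear N -> N'}),
    injective f -> injective (tensor_map M f).

Definition injective_module (A : pzRingType) (E : lmodType A) : Prop :=
  forall (X Y : lmodType A) (i : {linear X -> Y}) (u : {linear X -> E}),
    injective i -> exists v : {linear Y -> E}, forall x, v (i x) = u x.

Definition right_IF_ring (A : pzRingType) : Prop :=
  forall E : lmodType A^c, injective_module E -> flat_right_module E.

Record submodule_of (A : pzRingType) (V : lmodType A) (I : submodClosed V) :=
  Submodule { submodule_val : V; _ : submodule_val \in I }.

Section Submodule.
Variables (A : pzRingType) (V : lmodType A) (I : submodClosed V).
HB.instance Definition _ := [isSub for @submodule_val A V I].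
HB.instance Definition _ := [Choice of submodule_of I by <:].
HB.instance Definition _ := [SubChoice_isSubLmodule of submodule_of I by <:].
End Submodule.

Definition finitely_generated (A : pzRingType) (M : lmodType A) : Prop :=
  exists (n : nat) (p : {linear 'rV[A]_n -> M}), forall x, exists u, p u = x.

(* There is an exact sequence A^m -> A^n -> M -> 0. *)
Definition finitely_presented (A : pzRingType) (M : lmodType A) : Prop :=
  exists (m n : nat) (q : {linear 'rV[A]_m -> 'rV[A]_n})
         (p : {linear 'rV[A]_n -> M}),
    (forall x, exists u, p u = x) /\
    (forall u, p u = 0 <-> exists w, q w = u).

Definition left_coherent (A : pzRingType) : Prop :=
  forall I : submodClosed A^o,
    finitely_generated (submodule_of I) -> finitely_presented (submodule_of I).

Section Restriction.
Variables (S A : pzRingType) (f : {rmorphism S -> A}).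

(* Copies of A: lrestr f is a left S-module via s . a = f(s) a, and rrestr f a
   right S-module via a . s = a f(s). *)
Definition lrestr of {rmorphism S -> A} : Type := A.
HB.instance Definition _ := GRing.Zmodule.on (lrestr f).

Fact lrestr_scaleA (s t : S) (a : lrestr f) :
  f s * (f t * a) = f (s * t) * a :> A.
Proof. by rewrite rmorphM mulrA. Qed.
Fact lrestr_scale1 (a : lrestr f) : f 1 * a = a :> A.
Proof. by rewrite rmorph1 mul1r. Qed.
Fact lrestr_scaleDr (s : S) (a b : lrestr f) :
  f s * (a + b : A) = f s * a + f s * b :> A.
Proof. exact: mulrDr. Qed.
Fact lrestr_scaleDl (a : lrestr f) (s t : S) :
  f (s + t) * a = f s * a + f t * a :> A.
Proof. by rewrite rmorphD mulrDl. Qed.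

HB.instance Definition _ := GRing.Zmodule_isLmodule.Build S (lrestr f)
  lrestr_scaleA lrestr_scale1 lrestr_scaleDr lrestr_scaleDl.

Lemma lrestr_scaleE (s : S) (a : A) : s *: (a : lrestr f) = f s * a :> A.
Proof. by []. Qed.

Definition rrestr of {rmorphism S -> A} : Type := A.
HB.instance Definition _ := GRing.Zmodule.on (rrestr f).

Fact rrestr_scaleA (s t : S^c) (a : rrestr f) :
  a * f t * f s = a * f (s * t : S^c) :> A.
Proof. by rewrite -mulrA -rmorphM. Qed.
Fact rrestr_scale1 (a : rrestr f) : a * f (1 : S^c) = a :> A.
Proof. by rewrite -[RHS]mulr1 -(rmorph1 f). Qed.
Fact rrestr_scaleDr (s : S^c) (a b : rrestr f) :
  (a + b : A) * f s = a * f s + b * f s :> A.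
Proof. exact: mulrDl. Qed.
Fact rrestr_scaleDl (a : rrestr f) (s t : S^c) :
  a * f (s + t : S^c) = a * f s + a * f t :> A.
Proof. by rewrite -mulrDr -rmorphD. Qed.

HB.instance Definition _ := GRing.Zmodule_isLmodule.Build S^c (rrestr f)
  rrestr_scaleA rrestr_scale1 rrestr_scaleDr rrestr_scaleDl.

Lemma rrestr_scaleE (s : S) (a : A) : (s : S^c) *: (a : rrestr f) = a * f s :> A.
Proof. by []. Qed.

Definition tens_over (a b : A) : tensor (rrestr f) (lrestr f) :=
  tens (a : rrestr f) (b : lrestr f).

(* S is viewed as a subring of A along f, which is meant to be injective. The
   element sum_i a_i (x) b_i is the image of 1 under the bimodule splitting. *)
Definition separable_extension : Prop :=
  exists (n : nat) (a b : 'I_n -> A),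
    (forall x : A, \sum_(i < n) tens_over (a i) (b i * x) =
                   \sum_(i < n) tens_over (x * a i) (b i)) /\
    \sum_(i < n) a i * b i = 1.

End Restriction.

(* The axioms make each [s g] bijective, with inverse [s g^-1]. *)
Record ring_action (G : finGroupType) (R : pzRingType) := RingAction {
  ract :> G -> {rmorphism R -> R};
  ract1 : forall r, ract 1%g r = r;
  ractM : forall g h r, ract (g * h)%g r = ract g (ract h r)
}.

(* An element is its family of coefficients; the alias hides the pointwise ring
   structure of {ffun G -> R}. *)
Definition skew_group_ring (G : finGroupType) (R : pzRingType)
  of ring_action G R : Type := {ffun G -> R}.

Section SkewGroupRing.
Variables (G : finGroupType) (R : pzRingType) (s : ring_action G R).
Local Notation RG := (skew_group_ring s).
Implicit Types x y z : RG.

HB.instance Definition _ := GRing.Zmodule.on RG.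

Definition skew_coef x (g : G) : R := (x : {ffun G -> R}) g.

(* the element a g *)
Definition skew_mono (a : R) (g : G) : RG := [ffun k => if k == g then a else 0].

(* The coefficient of k = g h in x y collects the terms x_g g(y_h). *)
Definition skew_mul x y : RG :=
  [ffun k => \sum_(g : G) skew_coef x g * s g (skew_coef y (g^-1 * k)%g)].

Lemma skew_coef0 g : skew_coef 0 g = 0.
Proof. by rewrite /skew_coef ffunE. Qed.

Lemma skew_coefD x y g : skew_coef (x + y) g = skew_coef x g + skew_coef y g.
Proof. by rewrite /skew_coef ffunE. Qed.

Lemma skew_coefB x y g : skew_coef (x - y) g = skew_coef x g - skew_coef y g.
Proof. by rewrite /skew_coef !ffunE. Qed.

Lemma skew_coef_mono a g k : skew_coef (skew_mono a g) k = if k == g then a else 0.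
Proof. by rewrite /skew_coef ffunE. Qed.

Lemma skew_coef_mul x y k :
  skew_coef (skew_mul x y) k =
    \sum_(g : G) skew_coef x g * s g (skew_coef y (g^-1 * k)%g).
Proof. by rewrite {1}/skew_coef ffunE. Qed.

Lemma skew_ext x y : skew_coef x =1 skew_coef y -> x = y.
Proof. by move=> e; apply/ffunP. Qed.

Fact skew_mulA : associative skew_mul.
Proof.
move=> x y z; apply: skew_ext => k; rewrite !skew_coef_mul.
under [RHS]eq_bigr => g _ do rewrite skew_coef_mul mulr_suml.
rewrite exchange_big /=; apply: eq_bigr => h _.
rewrite skew_coef_mul rmorph_sum mulr_sumr.
rewrite (reindex_inj (mulgI h^-1)%g); apply: eq_bigr => g _.
by rewrite rmorphM -ractM mulrA invMg invgK -mulgA !mulKVg.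
Qed.

Fact skew_mul1 : left_id (skew_mono 1 1%g) skew_mul.
Proof.
move=> x; apply: skew_ext => k; rewrite skew_coef_mul (bigD1 1%g) //=.
rewrite skew_coef_mono eqxx mul1r ract1 invg1 mul1g big1 ?addr0 // => g ng.
by rewrite skew_coef_mono (negPf ng) mul0r.
Qed.

Fact skew_mulr1 : right_id (skew_mono 1 1%g) skew_mul.
Proof.
move=> x; apply: skew_ext => k; rewrite skew_coef_mul (bigD1 k) //=.
rewrite skew_coef_mono mulVg eqxx rmorph1 mulr1 big1 ?addr0 // => g ng.
rewrite skew_coef_mono -(inj_eq (mulgI g)) mulKVg mulg1 eq_sym (negPf ng).
by rewrite rmorph0 mulr0.
Qed.

Fact skew_mulDl : left_distributive skew_mul +%R.
Proof.
move=> x y z; apply: skew_ext => k; rewrite skew_coefD !skew_coef_mul -big_split.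
by apply: eq_bigr => g _; rewrite skew_coefD mulrDl.
Qed.

Fact skew_mulDr : right_distributive skew_mul +%R.
Proof.
move=> x y z; apply: skew_ext => k; rewrite skew_coefD !skew_coef_mul -big_split.
by apply: eq_bigr => g _; rewrite skew_coefD rmorphD mulrDr.
Qed.

HB.instance Definition _ := GRing.Zmodule_isPzRing.Build RG
  skew_mulA skew_mul1 skew_mulr1 skew_mulDl skew_mulDr.

Lemma skew_monoM a b g h :
  skew_mono a g * skew_mono b h = skew_mono (a * s g b) (g * h)%g :> RG.
Proof.
apply: skew_ext => k; rewrite skew_coef_mul (bigD1 g) //= big1 => [|g' ng].
  rewrite addr0 !skew_coef_mono eqxx -(inj_eq (mulgI g)) mulKVg.
  by case: eqP; rewrite // rmorph0 mulr0.
by rewrite skew_coef_mono (negPf ng) mul0r.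
Qed.

Lemma skew_sum_mono x : x = \sum_(g : G) skew_mono (skew_coef x g) g.
Proof.
apply: skew_ext => k; rewrite [in RHS]/skew_coef sum_ffunE (bigD1 k) //= big1.
  by rewrite ffunE eqxx addr0.
by move=> g ng; rewrite ffunE eq_sym (negPf ng).
Qed.

End SkewGroupRing.

Section SkewSubring.
Variables (G : finGroupType) (R : pzRingType) (s : ring_action G R).
Variable H : {group G}.

Fact sub_ract1 r : s (sgval (1%g : [subg H])) r = r.
Proof. exact: ract1. Qed.
Fact sub_ractM (g h : [subg H]) r :
  s (sgval (g * h)%g) r = s (sgval g) (s (sgval h) r).
Proof. exact: ractM. Qed.

Definition sub_ring_action : ring_action [subg H] R :=
  RingAction (ract := fun h => s (sgval h)) sub_ract1 sub_ractM.

Local Notation RG := (skew_group_ring s).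
Local Notation RH := (skew_group_ring sub_ring_action).

(* RH is the skew group ring of H for the restricted action; it is identified
   with the subring of RG of the elements supported on H. *)
Definition skew_incl (x : RH) : RG :=
  [ffun g => if g \in H then skew_coef x (subg H g) else 0].

Lemma skew_coef_incl x g :
  skew_coef (skew_incl x) g = if g \in H then skew_coef x (subg H g) else 0.
Proof. by rewrite {1}/skew_coef ffunE. Qed.

Fact skew_incl_zmod_morphism : zmod_morphism skew_incl.
Proof.
move=> x y; apply: skew_ext => g; rewrite skew_coefB !skew_coef_incl.
by case: ifP => _; rewrite ?subrr // skew_coefB.
Qed.

HB.instance Definition _ :=
  GRing.isZmodMorphism.Build RH RG skew_incl skew_incl_zmod_morphism.

Lemma skew_incl_mono a (h : [subg H]) :
  skew_incl (skew_mono _ a h) = skew_mono s a (sgval h).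
Proof.
apply: skew_ext => g; rewrite skew_coef_incl !skew_coef_mono.
case: ifPn => [gH | gNH].
  by rewrite -(inj_eq val_inj) /= subgK.
by case: eqP => // e; rewrite e subgP in gNH.
Qed.

Fact skew_incl_monoid_morphism : monoid_morphism skew_incl.
Proof.
split=> [|x y]; first exact: skew_incl_mono.
rewrite [x]skew_sum_mono [y]skew_sum_mono mulr_suml !raddf_sum mulr_suml.
apply: eq_bigr => g _; rewrite !mulr_sumr raddf_sum; apply: eq_bigr => h _.
by rewrite skew_monoM /= !skew_incl_mono skew_monoM.
Qed.

HB.instance Definition _ :=
  GRing.isMonoidMorphism.Build RH RG skew_incl skew_incl_monoid_morphism.

Lemma skew_incl_inj : injective skew_incl.
Proof.
move=> x y e; apply: skew_ext => h.
have := congr1 (fun z => skew_coef z (sgval h)) e.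
by rewrite !skew_coef_incl subgP sgvalK.
Qed.

End SkewSubring.

(* Main.v *)
(* RG is a Frobenius extension of RH: the elements of RG supported on H give an
   RH-bimodule projection pi : RG -> RH, and a transversal t_j of the right
   cosets of H gives dual bases t_j^-1, t_j whose tensor sum_j t_j^-1 (x) t_j
   commutes with RG. Everything below holds for a Frobenius extension A of S
   whose projection pi : A -> S also satisfies pi 1 = 1.
   - If E is S-injective then Hom_S(A, E) is A-injective, hence A-flat if A is
     right IF. An A-flat module M is S-flat, because M (x)_S N is a natural
     retract of M (x)_A Hom_S(A, N). Finally E is an S-retract of Hom_S(A, E).
   - If E is A-injective then it is S-injective: u : X -> E extends to the
     A-linear map Hom_S(A, X) -> E, phi |-> sum_j u(phi(t_j^-1)) t_j. So E is
     S-flat if S is right IF, and the separability element makes E (x)_A N a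
     natural retract of E (x)_S N. *)
From HB Require Import structures.
Require Import Defs.
From mathcomp Require Import all_fingroup all_boot all_order all_algebra.
From mathcomp Require Import boolp.

Set Implicit Arguments.
Unset Strict Implicit.
Unset Printing Implicit Defensive.

Import GRing.Theory.

Local Open Scope ring_scope.

(** * Linear maps, tensor products and retracts of flat modules *)

Lemma linear_exists (A : pzRingType) (U V : lmodType A) (g : U -> V) :
  linear g -> exists h : {linear U -> V}, h =1 g.
Proof.
move=> g_lin.
pose gL := GRing.isLinear.Build A U V *:%R g g_lin.
pose h : {linear U -> V} := HB.pack g gL.
by exists h.
Qed.

Lemma zmod_morphism_sum (U V : zmodType) (g : U -> V) : zmod_morphism g ->
  forall I (r : seq I) (F : I -> U),
  g (\sum_(i <- r) F i) = \sum_(i <- r) g (F i).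
Proof.
move=> gB I r F.
pose gM := GRing.isZmodMorphism.Build U V g gB.
pose h : {additive U -> V} := HB.pack g gM.
exact: (raddf_sum h).
Qed.

Section TensorFacts.
Variables (A : pzRingType) (M : lmodType A^c) (N : lmodType A).

Lemma tensor_ext (T : zmodType) (u v : tensor M N -> T) :
    zmod_morphism u -> zmod_morphism v ->
  (forall m n, u (tens m n) = v (tens m n)) -> u =1 v.
Proof.
move=> uB vB uv x; elim/tensor_ind: x => // [|x y xE yE].
  by rewrite -(subrr 0) uB vB !subrr.
by rewrite uB vB xE yE.
Qed.

Lemma tens0l (n : N) : tens (0 : M) n = 0 :> tensor M N.
Proof. by apply: (addIr (tens 0 n)); rewrite -tensDl !add0r. Qed.

Lemma tens_suml I (r : seq I) (F : I -> M) (n : N) :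
  tens (\sum_(i <- r) F i) n = \sum_(i <- r) tens (F i) n.
Proof.
exact: (big_morph (fun m => tens m n) (fun m m' => tensDl m m' n) (tens0l n)).
Qed.

End TensorFacts.

(* Flatness descends along a retraction of functors
   [M (x)_A -] ==> [M' (x)_B F(-)] ==> [M (x)_A -]. *)
Lemma flat_of_natural_retract (A B : pzRingType) (M : lmodType A^c)
    (M' : lmodType B^c) (F : lmodType A -> lmodType B)
    (i : forall N : lmodType A, M -> N -> tensor M' (F N))
    (p : forall N : lmodType A, M' -> F N -> tensor M N)
    (Ff : forall N N' : lmodType A, {linear N -> N'} -> {linear F N -> F N'}) :
    (forall (N N' : lmodType A) (f : {linear N -> N'}),
       injective f -> injective (@Ff N N' f)) ->
    (forall N, balanced (@i N)) -> (forall N, balanced (@p N)) ->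
    (forall (N N' : lmodType A) (f : {linear N -> N'}) m n,
       tensor_map M' (@Ff N N' f) (i N m n) = i N' m (f n)) ->
    (forall N m n, tensor_lift (@p N) (i N m n) = tens m n) ->
  flat_right_module M' -> flat_right_module M.
Proof.
move=> F_inj i_bal p_bal i_nat ip M'_flat N N' f f_inj.
pose g := tensor_lift (@i N); pose g' := tensor_lift (@i N').
have gK : cancel g (tensor_lift (@p N)).
  apply: tensor_ext => [x y|//|m n]; last by rewrite /g tensor_liftE ?ip.
  by rewrite /g !tensor_lift_zmod_morphism.
have nat_g x : tensor_map M' (Ff _ _ f) (g x) = g' (tensor_map M f x).
  move: x; apply: tensor_ext => [x y|x y|m n].
  - by rewrite /g tensor_lift_zmod_morphism // raddfB.
  - by rewrite raddfB /g' tensor_lift_zmod_morphism.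
  - by rewrite /g /g' tensor_mapE !tensor_liftE ?i_nat.
move=> x y xy; apply: (can_inj gK).
by apply: (M'_flat _ _ (Ff _ _ f) (F_inj _ _ f f_inj)); rewrite !nat_g xy.
Qed.

Lemma flat_retract (A : pzRingType) (M M' : lmodType A^c)
    (i : {linear M -> M'}) (p : {linear M' -> M}) :
  cancel i p -> flat_right_module M' -> flat_right_module M.
Proof.
move=> iK; apply: (@flat_of_natural_retract _ _ _ _ id
  (fun N m n => tens (i m) n) (fun N m n => tens (p m) n) (fun _ _ f => f)).
- by [].
- move=> N; split=> [m m' n|m n n'|m a n]; first by rewrite linearD tensDl.
    exact: tensDr.
  by rewrite linearZ tensZ.
- move=> N; split=> [m m' n|m n n'|m a n]; first by rewrite linearD tensDl.
    exact: tensDr.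
  by rewrite linearZ tensZ.
- by move=> N N' f m n; rewrite tensor_mapE.
move=> N m n; rewrite tensor_liftE ?iK //.
split=> [m1 m' n1|m1 n1 n'|m1 a n1]; first by rewrite linearD tensDl.
  exact: tensDr.
by rewrite linearZ tensZ.
Qed.

(** * Restriction of scalars and coinduction along a ring morphism *)

Section ChangeOfRings.
Variables (S A : pzRingType) (f : {rmorphism S -> A}).

(** Right modules are left modules over the converse ring, so restricting a right [A]-module to [S]
    means restricting along this map. *)
Definition converse_mor : S^c -> A^c := f.

Fact converse_mor_zmod_morphism : zmod_morphism converse_mor.
Proof. exact: (rmorphB f). Qed.
HB.instance Definition _ := GRing.isZmodMorphism.Build S^c A^c converse_mor
  converse_mor_zmod_morphism.

Fact converse_mor_monoid_morphism : monoid_morphism converse_mor.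
Proof. by split=> [|s t]; [exact: (rmorph1 f) | exact: (rmorphM f t s)]. Qed.
HB.instance Definition _ := GRing.isMonoidMorphism.Build S^c A^c converse_mor
  converse_mor_monoid_morphism.

Definition converse_rmorphism : {rmorphism S^c -> A^c} := converse_mor.

Definition restr_module of {rmorphism S -> A} := fun M : lmodType A => M : Type.

Section Restr.
Variable M : lmodType A.
Local Notation restrM := (restr_module f M).
HB.instance Definition _ := GRing.Zmodule.on restrM.

Fact restr_scaleA (s t : S) (m : restrM) :
  f s *: (f t *: (m : M)) = f (s * t) *: (m : M).
Proof. by rewrite rmorphM scalerA. Qed.
Fact restr_scale1 (m : restrM) : f 1 *: (m : M) = m.
Proof. by rewrite rmorph1 scale1r. Qed.
Fact restr_scaleDr (s : S) (m m' : restrM) :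
  f s *: (m + m' : M) = f s *: (m : M) + f s *: (m' : M).
Proof. exact: scalerDr. Qed.
Fact restr_scaleDl (m : restrM) (s t : S) :
  f (s + t) *: (m : M) = f s *: (m : M) + f t *: (m : M).
Proof. by rewrite rmorphD scalerDl. Qed.
HB.instance Definition _ := GRing.Zmodule_isLmodule.Build S restrM
  restr_scaleA restr_scale1 restr_scaleDr restr_scaleDl.

Lemma restr_scaleE s (m : restrM) : s *: m = f s *: (m : M) :> M.
Proof. by []. Qed.

End Restr.

Definition restr_map (M M' : lmodType A) (g : M -> M') :
  restr_module f M -> restr_module f M' := g.

Section RestrMap.
Variables (M M' : lmodType A) (g : {linear M -> M'}).
Fact restr_map_linear : linear (restr_map g).
Proof. by move=> s m m'; rewrite /restr_map linearP. Qed.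
HB.instance Definition _ := GRing.isLinear.Build S (restr_module f M)
  (restr_module f M') _ (restr_map g) restr_map_linear.
End RestrMap.

(* Hom_S(A, N), where A is a left S-module through f, with the left action
   (a phi)(x) = phi(x a). *)
Record coind (N : lmodType S) := Coind {
  coind_fun :> A -> N;
  coindP : `[< linear (coind_fun : lrestr f -> N) >]
}.

Section Coind.
Variable N : lmodType S.
Local Notation coindN := (coind N).

HB.instance Definition _ := [isSub for @coind_fun N].
HB.instance Definition _ := gen_eqMixin coindN.
HB.instance Definition _ := gen_choiceMixin coindN.

Lemma coind_ext (u v : coindN) : u =1 v -> u = v.
Proof. by move=> uv; apply: val_inj; apply: funext. Qed.

Lemma coind_linear (u : coindN) : linear (u : lrestr f -> N).
Proof. exact/asboolP/coindP. Qed.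

Lemma coindD (u : coindN) x y : u (x + y) = u x + u y.
Proof. by have := coind_linear u 1 x y; rewrite !scale1r. Qed.

Lemma coind0 (u : coindN) : u 0 = 0.
Proof. by apply: (addIr (u 0)); rewrite -coindD !add0r. Qed.

Lemma coindZ (u : coindN) s x : u (f s * x) = s *: u x.
Proof. by have := coind_linear u s x 0; rewrite !addr0 coind0 addr0. Qed.

Fact coind_zero_subproof : `[< linear ((fun=> 0) : lrestr f -> N) >].
Proof. by apply/asboolP => s x y; rewrite scaler0 addr0. Qed.
Fact coind_opp_subproof (u : coindN) :
  `[< linear ((fun x => - u x) : lrestr f -> N) >].
Proof. by apply/asboolP => s x y; rewrite coind_linear opprD scalerN. Qed.
Fact coind_add_subproof (u v : coindN) :
  `[< linear ((fun x => u x + v x) : lrestr f -> N) >].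
Proof. by apply/asboolP => s x y; rewrite !coind_linear scalerDr addrACA. Qed.
Fact coind_scale_subproof (a : A) (u : coindN) :
  `[< linear ((fun x => u (x * a)) : lrestr f -> N) >].
Proof.
apply/asboolP => s x y.
by rewrite -coindZ -coindD mulrA -mulrDl.
Qed.

Definition coind_zero : coindN := Coind coind_zero_subproof.
Definition coind_opp u : coindN := Coind (coind_opp_subproof u).
Definition coind_add u v : coindN := Coind (coind_add_subproof u v).
Definition coind_scale a u : coindN := Coind (coind_scale_subproof a u).

Fact coind_addA : associative coind_add.
Proof. by move=> u v w; apply: coind_ext => x /=; rewrite addrA. Qed.
Fact coind_addC : commutative coind_add.
Proof. by move=> u v; apply: coind_ext => x /=; rewrite addrC. Qed.
Fact coind_add0 : left_id coind_zero coind_add.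
Proof. by move=> u; apply: coind_ext => x /=; rewrite add0r. Qed.
Fact coind_addN : left_inverse coind_zero coind_opp coind_add.
Proof. by move=> u; apply: coind_ext => x /=; rewrite addNr. Qed.
HB.instance Definition _ := GRing.isZmodule.Build coindN
  coind_addA coind_addC coind_add0 coind_addN.

Fact coind_scaleA a b u : coind_scale a (coind_scale b u) = coind_scale (a * b) u.
Proof. by apply: coind_ext => x /=; rewrite mulrA. Qed.
Fact coind_scale1 : left_id 1 coind_scale.
Proof. by move=> u; apply: coind_ext => x /=; rewrite mulr1. Qed.
Fact coind_scaleDr : right_distributive coind_scale +%R.
Proof. by move=> a u v; apply: coind_ext. Qed.
Fact coind_scaleDl u : {morph coind_scale^~ u : a b / a + b}.
Proof. by move=> a b; apply: coind_ext => x /=; rewrite mulrDr coindD. Qed.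
HB.instance Definition _ := GRing.Zmodule_isLmodule.Build A coindN
  coind_scaleA coind_scale1 coind_scaleDr coind_scaleDl.

Lemma coind_addE (u v : coindN) x : (u + v) x = u x + v x.
Proof. by []. Qed.
Lemma coind_scaleE a (u : coindN) x : (a *: u) x = u (x * a).
Proof. by []. Qed.

End Coind.

Section CoindMap.
Variables (N N' : lmodType S) (g : {linear N -> N'}).

Fact coind_map_subproof (u : coind N) :
  `[< linear ((fun x => g (u x)) : lrestr f -> N') >].
Proof. by apply/asboolP => s x y; rewrite coind_linear linearP. Qed.
Definition coind_map u : coind N' := Coind (coind_map_subproof u).

Fact coind_map_linear : linear coind_map.
Proof. by move=> a u v; apply: coind_ext => x /=; rewrite linearD. Qed.
HB.instance Definition _ := GRing.isLinear.Build A (coind N) (coind N') _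
  coind_map coind_map_linear.

Lemma coind_map_inj : injective g -> injective coind_map.
Proof.
move=> g_inj u v uv; apply: coind_ext => x; apply: g_inj.
exact: (congr1 (fun w : coind N' => w x) uv).
Qed.
End CoindMap.

(** Coinduction is right adjoint to restriction, which preserves injective maps. The extension
    problem is transported along the adjunction, solved in [E], and transported back. *)
Lemma coind_injective (E : lmodType S) :
  injective_module E -> injective_module (coind E).
Proof.
move=> E_inj X Y i u i_inj.
(* The adjoint of [u]: evaluation at 1, which is [S]-linear. *)
have [|u1 u1E] := @linear_exists _ (restr_module f X) E (fun x => u x 1).
  by move=> s x y; rewrite linearP coind_addE coind_scaleE mul1r -coindZ mulr1.
have [w wE] := E_inj _ _ (restr_map i) u1 i_inj.
(* The inverse adjunction sends [w] to the map taking [y] to [a |-> w (a y)]. *)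
have v_lin y : `[< linear ((fun a => w (a *: (y : Y))) : lrestr f -> E) >].
  apply/asboolP => s a b; rewrite -linearP; congr (w _).
  by rewrite scalerDl restr_scaleE scalerA.
have [|v vE] := @linear_exists _ Y (coind E) (fun y => Coind (v_lin y)).
  move=> a y z; apply: coind_ext => x /=.
  by rewrite scalerDr scalerA linearD.
exists v => x; rewrite vE; apply: coind_ext => a /=.
rewrite -linearZ; have := wE (a *: x); rewrite /restr_map => ->.
by rewrite u1E linearZ coind_scaleE mul1r.
Qed.

End ChangeOfRings.
Arguments restr_map {S A} f {M M'} g.
Arguments coind_map {S A} f {N N'} g u.

(** * Separable and Frobenius extensions *)

Section RingExtension.
Variables (S A : pzRingType) (f : {rmorphism S -> A}).

(* [balanced] for A (x)_S A with the restrictions of scalars unfolded, so that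
   exchanging x and y gives the same notion for the converse rings. *)
Definition middle_linear (T : zmodType) (b : A -> A -> T) : Prop :=
  [/\ forall x y z, b (x + y) z = b x z + b y z,
      forall x y z, b x (y + z) = b x y + b x z
    & forall x s y, b (x * f s) y = b x (f s * y)].

(* The tensor [sum p.1 (x) p.2] of A (x)_S A commutes with A, stated through
   the universal property of the tensor product. *)
Definition casimir (r : seq (A * A)) : Prop :=
  forall (T : zmodType) (b : A -> A -> T), middle_linear b ->
  forall x, \sum_(p <- r) b (x * p.1) p.2 = \sum_(p <- r) b p.1 (p.2 * x).

(** The last two identities are the dual basis expansions at 1; by [frob_casimir] they yield
    [x = sum f (pi (x p.1)) p.2] and [x = sum p.1 f (pi (p.2 x))] for every [x]. *)
Record frobenius_system (pi : A -> S) (r : seq (A * A)) : Prop := {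
  frobD : {morph pi : x y / x + y};
  frobMl : forall s x, pi (f s * x) = s * pi x;
  frobMr : forall s x, pi (x * f s) = pi x * s;
  frob1 : pi 1 = 1;
  frob_casimir : casimir r;
  frob_dual : \sum_(p <- r) f (pi p.1) * p.2 = 1;
  frob_dualr : \sum_(p <- r) p.1 * f (pi p.2) = 1
}.

(** Applying the map induced by a middle linear [B] to the equation in [A (x)_S A] gives the Casimir
    identity for [B]. *)
Lemma separable_casimir :
  separable_extension f -> exists2 r, casimir r & \sum_(p <- r) p.1 * p.2 = 1.
Proof.
case=> n [a [b [ab ab1]]].
exists [seq (a i, b i) | i <- index_enum 'I_n]; last by rewrite big_map.
move=> T B [BDl BDr BZ] x; rewrite !big_map.
pose B' (u : rrestr f) (v : lrestr f) := B u v.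
have B'_bal : balanced B' by split=> [||u s v]; [exact: BDl|exact: BDr|exact: BZ].
have liftE (u v : 'I_n -> A) :
    tensor_lift B' (\sum_(i < n) tens_over f (u i) (v i)) =
    \sum_(i < n) B (u i) (v i).
  rewrite (zmod_morphism_sum (tensor_lift_zmod_morphism B'_bal)).
  by apply: eq_bigr => i _; exact: (tensor_liftE B'_bal).
by rewrite -liftE -ab liftE.
Qed.

(** The section of [M (x)_S N -> M (x)_A N] is [m (x) n |-> sum m p.1 (x) p.2 n]: it is [A]-balanced
    by the Casimir identity, and the composite multiplies [m] by [sum p.1 p.2 = 1]. *)
Lemma flat_of_separable (M : lmodType A^c) :
    separable_extension f ->
    flat_right_module (restr_module (converse_rmorphism f) M : lmodType S^c) ->
  flat_right_module M.
Proof.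
case/separable_casimir=> r r_cas r1.
pose restrM : lmodType S^c := restr_module (converse_rmorphism f) M.
pose restr (N : lmodType A) : lmodType S := restr_module f N.
pose i (N : lmodType A) (m : M) (n : N) : tensor restrM (restr N) :=
  \sum_(p <- r) tens (((p.1 : A^c) *: m) : restrM) (p.2 *: n : restr N).
pose q (N : lmodType A) (m : restrM) (n : restr N) : tensor M N :=
  tens (m : M) (n : N).
have q_bal N : balanced (@q N).
  by split=> [m m' n|m n n'|m s n]; [exact: tensDl|exact: tensDr|exact: tensZ].
apply: (@flat_of_natural_retract _ _ M restrM restr i q
  (fun N N' g => restr_map f g)) => //.
- move=> N; split=> [m m' n|m n n'|m a n]; rewrite /i.
  + by rewrite -big_split; apply: eq_bigr => p _; rewrite scalerDr; exact: tensDl.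
  + by rewrite -big_split; apply: eq_bigr => p _; rewrite scalerDr; exact: tensDr.
  + pose b (x y : A) : tensor restrM (restr N) :=
      tens (((x : A^c) *: m) : restrM) (y *: n : restr N).
    under eq_bigr do rewrite scalerA.
    under [RHS]eq_bigr do rewrite scalerA.
    apply: (r_cas _ b); split=> [x y z|x y z|x s y]; rewrite /b.
    * by rewrite scalerDl; exact: tensDl.
    * by rewrite scalerDl; exact: tensDr.
    * have := @tensZ _ restrM (restr N) ((x : A^c) *: m) s (y *: n).
      by rewrite !restr_scaleE !scalerA.
- move=> N N' g m n; rewrite /i.
  rewrite (zmod_morphism_sum
    (@tensor_map_zmod_morphism S restrM (restr N) (restr N') (restr_map f g))).
  apply: eq_bigr => p _; rewrite -linearZ.
  exact: (@tensor_mapE S restrM (restr N) (restr N') (restr_map f g)).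
- move=> N m n; rewrite /i.
  rewrite (zmod_morphism_sum (tensor_lift_zmod_morphism (q_bal N))).
  under eq_bigr do rewrite tensor_liftE // /q -tensZ scalerA.
  by rewrite -tens_suml -scaler_suml [X in X *: m]r1 scale1r.
Qed.

Section Frobenius.
Variables (pi : A -> S) (r : seq (A * A)).
Hypothesis frob : frobenius_system pi r.

Fact coind_proj_subproof (N : lmodType S) (n : N) :
  `[< linear ((fun x => pi x *: n) : lrestr f -> N) >].
Proof.
apply/asboolP=> s x y.
by rewrite scalerA -scalerDl -(frobMl frob) -(frobD frob).
Qed.
(** Under the Frobenius isomorphism from [A (x)_S N] to [Hom_S(A, N)],
    [a (x) n |-> (x |-> pi (x a) n)], this is the image of [1 (x) n]. *)
Definition coind_proj (N : lmodType S) (n : N) : coind f N :=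
  Coind (coind_proj_subproof n).

Lemma coind_projD (N : lmodType S) : {morph @coind_proj N : n n' / n + n'}.
Proof. by move=> n n'; apply: coind_ext => x /=; rewrite scalerDr. Qed.

Lemma coind_projZ (N : lmodType S) s (n : N) :
  coind_proj (s *: n) = f s *: coind_proj n.
Proof. by apply: coind_ext => x /=; rewrite scalerA (frobMr frob). Qed.

Lemma coind_map_proj (N N' : lmodType S) (g : {linear N -> N'}) n :
  coind_map f g (coind_proj n) = coind_proj (g n).
Proof. by apply: coind_ext => x /=; rewrite linearZ. Qed.

(** Evaluation at 1 undoes [coind_proj] because [pi 1 = 1]. *)
Lemma restr_coind_retract (N : lmodType S) :
  exists (i : {linear N -> restr_module f (coind f N)})
         (p : {linear restr_module f (coind f N) -> N}), cancel i p.
Proof.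
have [|i iE] :=
    @linear_exists _ N (restr_module f (coind f N)) (@coind_proj N).
  by move=> s n n'; rewrite coind_projD coind_projZ.
have [|p pE] := @linear_exists _ (restr_module f (coind f N)) N (fun u => u 1).
  by move=> s u v; rewrite coind_addE coind_scaleE mul1r -coindZ mulr1.
by exists i, p => n; rewrite pE iE /= (frob1 frob) scale1r.
Qed.

Lemma restr_injective (E : lmodType A) :
  injective_module E -> injective_module (restr_module f E).
Proof.
move=> E_inj X Y i u i_inj.
have uZ t z : u (t *: z) = f t *: (u z : E) :> E by rewrite linearZ.
(* [A]-linear by the Casimir identity: [sum a p.1 u(w(p.2)) = sum p.1 u(w(p.2 a))]. On
   [coind_proj x] it returns [(sum p.1 f (pi p.2)) u(x) = u(x)]. *)
pose u0 (w : coind f X) : E := \sum_(p <- r) p.1 *: (u (w p.2) : E).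
have [|u1 u1E] := @linear_exists _ (coind f X) E u0.
  move=> a v w; rewrite /u0 scaler_sumr.
  under [X in _ = X + _]eq_bigr do rewrite scalerA.
  pose b (x y : A) := x *: (u (v y) : E).
  have b_ml : middle_linear b.
    split=> [x y z|x y z|x s y]; rewrite /b; first by rewrite scalerDl.
      by rewrite coindD linearD scalerDr.
    by rewrite coindZ uZ scalerA.
  rewrite [X in _ = X + _](frob_casimir frob b_ml) -big_split.
  by apply: eq_bigr => p _ /=; rewrite linearD scalerDr.
have [v vE] := E_inj _ _ (coind_map f i) u1 (coind_map_inj i_inj).
have [|v1 v1E] :=
    @linear_exists _ Y (restr_module f E) (fun y => v (coind_proj y)).
  by move=> s y z; rewrite coind_projD coind_projZ linearP.
exists v1 => x; rewrite v1E -coind_map_proj vE u1E /u0 /=.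
under eq_bigr do rewrite uZ scalerA.
by rewrite -scaler_suml (frob_dualr frob) scale1r.
Qed.

(** The retraction [q] is [A]-balanced by the Casimir identity. The composite sends [m (x) n] to
    [sum m p.1 (x) pi(p.2) n]; moving [pi(p.2)] to the left factor gives [m (x) n] by the dual basis
    identity. *)
Lemma restr_flat (M : lmodType A^c) :
  flat_right_module M ->
  flat_right_module (restr_module (converse_rmorphism f) M : lmodType S^c).
Proof.
pose restrM : lmodType S^c := restr_module (converse_rmorphism f) M.
pose i (N : lmodType S) (m : restrM) (n : N) : tensor M (coind f N) :=
  tens (m : M) (coind_proj n).
pose q (N : lmodType S) (m : M) (u : coind f N) : tensor restrM N :=
  \sum_(p <- r) tens (((p.1 : A^c) *: m) : restrM) (u p.2).
have q_bal N : balanced (@q N).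
  split=> [m m' u|m u v|m a u]; rewrite /q.
  - by rewrite -big_split; apply: eq_bigr => p _; rewrite scalerDr; exact: tensDl.
  - by rewrite -big_split; apply: eq_bigr => p _; rewrite coind_addE tensDr.
  - pose b (x y : A) := tens (((x : A^c) *: m) : restrM) (u y).
    under eq_bigr do rewrite scalerA.
    apply: (frob_casimir frob (b := b)).
    split=> [x y z|x y z|x s y]; rewrite /b.
    + by rewrite scalerDl; exact: tensDl.
    + by rewrite coindD tensDr.
    + have := @tensZ _ restrM N ((x : A^c) *: m) s (u y).
      by rewrite coindZ restr_scaleE scalerA.
apply: (@flat_of_natural_retract _ _ restrM M (coind f) i q
  (fun N N' g => coind_map f g)) => //.
- by move=> N N' g; exact: coind_map_inj.
- move=> N; split=> [m m' n|m n n'|m s n]; rewrite /i.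
  + exact: tensDl.
  + by rewrite coind_projD tensDr.
  + by rewrite coind_projZ -tensZ.
- by move=> N N' g m n; rewrite /i tensor_mapE /= coind_map_proj.
- move=> N m n; rewrite /i tensor_liftE; last exact: q_bal.
  have mE : \sum_(p <- r) (p.1 * f (pi p.2) : A^c) *: m = m :> M.
    by rewrite -scaler_suml [X in X *: _](frob_dualr frob) scale1r.
  rewrite /q; under eq_bigr do rewrite /= -tensZ restr_scaleE scalerA.
  rewrite -tens_suml.
  exact: (congr1 (fun m' => tens (m' : restrM) n) mE).
Qed.

End Frobenius.

End RingExtension.

(** The axioms are left-right symmetric: swapping the pairs exchanges the two module laws for [pi]
    and the two dual basis identities. This carries the results on left modules over to right
    modules. *)
Lemma frobenius_converse (S A : pzRingType) (f : {rmorphism S -> A})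
    (pi : A -> S) (r : seq (A * A)) :
  frobenius_system f pi r ->
  frobenius_system (converse_rmorphism f) (pi : A^c -> S^c) [seq (p.2, p.1) | p <- r].
Proof.
case=> piD piMl piMr pi1 r_cas r_dual r_dualr; split=> //.
- move=> T b [bDl bDr bZ] x; rewrite !big_map.
  have b'_ml : middle_linear f (fun y z => b z y).
    by split=> [y z w|y z w|y t z]; [exact: bDr|exact: bDl|exact/esym/bZ].
  exact/esym/(r_cas T _ b'_ml).
- by rewrite big_map.
- by rewrite big_map.
Qed.

(** * Transfer of the IF property along a Frobenius extension *)

Section FrobeniusIF.
Variables (S A : pzRingType) (f : {rmorphism S -> A}).
Variables (pi : A -> S) (r : seq (A * A)).
Hypothesis frob : frobenius_system f pi r.

Lemma right_IF_restr : right_IF_ring A -> right_IF_ring S.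
Proof.
move=> A_IF E E_inj.
(* Coinduction of the right module [E] takes place over the converse rings, while [restr_flat] uses
   the original system. *)
have [i [p iK]] := restr_coind_retract (frobenius_converse frob) E.
apply: flat_retract iK _; apply: (restr_flat frob).
exact/A_IF/coind_injective.
Qed.

Lemma right_IF_separable :
  separable_extension f -> right_IF_ring S -> right_IF_ring A.
Proof.
move=> f_sep S_IF E E_inj; apply: (flat_of_separable f_sep).
exact/S_IF/(restr_injective (frobenius_converse frob)).
Qed.

End FrobeniusIF.

(** * The Frobenius system of a skew group ring over a subgroup *)

Section SkewFrobenius.
Variables (R : pzRingType) (G : finGroupType) (s : ring_action G R).
Variable H : {group G}.

Local Notation RG := (skew_group_ring s).
Local Notation RH := (skew_group_ring (sub_ring_action s H)).
Local Notation incl := (@skew_incl G R s H).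

Definition skew_proj (x : RG) : RH := [ffun h => skew_coef x (sgval h)].

Definition skew_dual_bases : seq (RG * RG) :=
  [seq (skew_mono s 1 (fingroup.repr C)^-1%g, skew_mono s 1 (fingroup.repr C))
     | C : {set G} <- enum (rcosets H [set: G])].

Lemma skew_proj_mono a g :
  skew_proj (skew_mono s a g) = if g \in H then skew_mono _ a (subg H g) else 0.
Proof.
apply: skew_ext => h; rewrite /skew_proj {1}/skew_coef ffunE skew_coef_mono.
case: ifPn => [/eqP <-|hg].
  by rewrite subgP sgvalK skew_coef_mono eqxx.
case: ifPn => [gH|_]; last by rewrite skew_coef0.
rewrite skew_coef_mono; case: eqP => // hE.
by rewrite hE subgK // eqxx in hg.
Qed.


Fact skew_proj_zmod_morphism : zmod_morphism skew_proj.
Proof.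
move=> x y; apply: skew_ext => h.
by rewrite skew_coefB /skew_proj /skew_coef !ffunE -skew_coefB.
Qed.
HB.instance Definition _ :=
  GRing.isZmodMorphism.Build RG RH skew_proj skew_proj_zmod_morphism.

Lemma skew_incl_projMl (t : RH) (x : RG) :
  skew_proj (incl t * x) = t * skew_proj x.
Proof.
rewrite [t]skew_sum_mono [x]skew_sum_mono !raddf_sum !mulr_suml raddf_sum.
apply: eq_bigr => h _; rewrite !mulr_sumr raddf_sum; apply: eq_bigr => g _ /=.
rewrite skew_incl_mono skew_monoM !skew_proj_mono groupMl ?subgP //.
case: ifP => [gH|_]; last by rewrite mulr0.
rewrite skew_monoM; congr skew_mono.
by apply: val_inj; rewrite /= !subgK // groupMl ?subgP.
Qed.

Lemma skew_incl_projMr (t : RH) (x : RG) :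
  skew_proj (x * incl t) = skew_proj x * t.
Proof.
rewrite [t]skew_sum_mono [x]skew_sum_mono !raddf_sum !mulr_suml raddf_sum.
apply: eq_bigr => g _; rewrite !mulr_sumr raddf_sum; apply: eq_bigr => h _ /=.
rewrite skew_incl_mono skew_monoM !skew_proj_mono groupMr ?subgP //.
case: ifP => [gH|_]; last by rewrite mul0r.
rewrite skew_monoM /= subgK //; congr skew_mono.
by apply: val_inj; rewrite /= !subgK // groupMr ?subgP.
Qed.

Lemma skew_proj1 : skew_proj 1 = 1.
Proof.
rewrite skew_proj_mono group1; congr skew_mono.
by apply: val_inj; rewrite /= subgK.
Qed.

(** Right translation permutes the right cosets; this justifies the reindexing in the Casimir
    identity. *)
Lemma rcosets_translate g C :
  (C :* g \in rcosets H [set: G])%g = (C \in rcosets H [set: G]).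
Proof.
suff tr k D : D \in rcosets H [set: G] -> (D :* k \in rcosets H [set: G])%g.
  apply/idP/idP => [/(tr g^-1%g)|]; last exact: tr.
  by rewrite -rcosetM mulgV mulg1.
case/rcosetsP=> x _ ->; rewrite -rcosetM.
by apply/rcosetsP; exists (x * k)%g; rewrite ?inE.
Qed.

Lemma repr_in_subgroup C :
  C \in rcosets H [set: G] -> (fingroup.repr C \in H) = (C == H :> {set G}).
Proof.
case/rcosetsP=> x _ ->; apply/idP/eqP => [|->]; last by rewrite repr_group.
case: repr_rcosetP => h hH; rewrite groupMl // => xH.
by rewrite rcoset_id.
Qed.

(** By additivity [x = a g]. Both sides then sum one function [psi], constant on the right cosets of
    [H], over all these cosets; the right side has them translated by [g]. *)
Lemma skew_casimir : casimir incl skew_dual_bases.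
Proof.
move=> T B [BDl BDr BZ] x; rewrite !big_map !big_enum /=.
have BBl y : zmod_morphism (B^~ y).
  by move=> u v; apply: (addIr (B v y)); rewrite /= -BDl !subrK.
have BBr y : zmod_morphism (B y).
  by move=> u v; apply: (addIr (B y v)); rewrite -BDr !subrK.
rewrite [x]skew_sum_mono.
under eq_bigr do rewrite mulr_suml (zmod_morphism_sum (BBl _)).
under [RHS]eq_bigr do rewrite mulr_sumr (zmod_morphism_sum (BBr _)).
rewrite exchange_big [RHS]exchange_big; apply: eq_bigr => g _ /=.
set a := skew_coef x g.
pose psi k := B (skew_mono s a g * skew_mono s 1 k^-1%g) (skew_mono s 1 k).
(* The factor [h^-1] of [(h k)^-1] lies in [RH], so it crosses the tensor sign and cancels [h]. *)
have psiH h k : h \in H -> psi (h * k)%g = psi k.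
  move=> hH; rewrite /psi invMg.
  have -> : skew_mono s 1 (k^-1 * h^-1)%g =
      skew_mono s 1 k^-1%g * incl (skew_mono _ 1 (subg H h^-1)).
    by rewrite skew_incl_mono skew_monoM rmorph1 mulr1 subgK ?groupV.
  rewrite mulrA BZ /= skew_incl_mono [X in B _ X]skew_monoM rmorph1 mulr1.
  by rewrite subgK ?groupV // mulKg.
(* Here [k (a g) = k(a) (k g)] and [a g (k g)^-1 = k^-1 k(a)]; the scalar [k(a)] lies in [RH] and
   crosses the tensor sign. *)
have psig k :
    B (skew_mono s 1 k^-1%g) (skew_mono s 1 k * skew_mono s a g) = psi (k * g)%g.
  rewrite /psi invMg.
  have -> : skew_mono s a g * skew_mono s 1 (g^-1 * k^-1)%g =
      skew_mono s 1 k^-1%g * incl (skew_mono _ (s k a) 1%g).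
    rewrite skew_incl_mono !skew_monoM rmorph1 mulr1 mulKVg mul1r -ractM.
    by rewrite mulVg ract1 mulg1.
  by rewrite BZ /= skew_incl_mono !skew_monoM rmorph1 mulr1 mul1g mul1r.
rewrite (reindex_inj (rcoset_inj (x := g))) /=.
under [RHS]eq_bigr do rewrite psig.
apply: eq_big => C; rewrite rcosets_translate // => /rcosetsP[y _ ->].
(* The representative of [H y g] and the translate by [g] of that of [H y] both lie in [H y g],
   where [psi] is constant. *)
rewrite -rcosetM -/(psi _); case: (repr_rcosetP H (y * g)) => h hH.
by case: (repr_rcosetP H y) => k kH; rewrite -mulgA (psiH h) ?(psiH k).
Qed.

Lemma skew_frobenius_system : frobenius_system incl skew_proj skew_dual_bases.
Proof.
split.
- exact: raddfD.
- exact: skew_incl_projMl.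
- exact: skew_incl_projMr.
- exact: skew_proj1.
- exact: skew_casimir.
(* Only the coset [H] has its representative in [H], and that representative is 1; every other term
   is killed by [skew_proj]. *)
- rewrite big_map big_enum (bigD1 (H : {set G})) /=; last first.
    by apply/rcosetsP; exists 1%g; rewrite ?inE ?rcoset1.
  rewrite repr_group invg1 skew_proj1 rmorph1 mul1r big1 ?addr0 // => C.
  case/andP=> CH nCH.
  by rewrite skew_proj_mono groupV repr_in_subgroup // (negPf nCH) rmorph0 mul0r.
- rewrite big_map big_enum (bigD1 (H : {set G})) /=; last first.
    by apply/rcosetsP; exists 1%g; rewrite ?inE ?rcoset1.
  rewrite repr_group invg1 skew_proj1 rmorph1 mulr1 big1 ?addr0 // => C.
  case/andP=> CH nCH.
  by rewrite skew_proj_mono repr_in_subgroup // (negPf nCH) rmorph0 mulr0.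
Qed.

End SkewFrobenius.

Theorem corollary7p5 (R : pzRingType) (G : finGroupType)
    (s : ring_action G R) (H : {group G}) :
  left_coherent R ->
  (right_IF_ring (skew_group_ring s) ->
     right_IF_ring (skew_group_ring (sub_ring_action s H))) /\
  (separable_extension (@skew_incl G R s H) ->
     (right_IF_ring (skew_group_ring s) <->
        right_IF_ring (skew_group_ring (sub_ring_action s H)))).
Proof.
have frob := skew_frobenius_system s H.
move=> _; split=> [|RG_sep]; first exact: right_IF_restr frob.
by split; [exact: right_IF_restr frob | exact: right_IF_separable frob RG_sep].
Qed.
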